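(* Let $\{T_w\}_{w\in U}$ be an interpolating family of operators between two interpolation scales $\{X_w\}_{w\in U}$ and $\{Y_w\}_{w\in U}$. Assume that $\kappa(T_{w_0})$ is finite for some $w_0\in U$. Then there exist a neighborhood $\omega$ of $w_0$ in $U$ and a finite positive constant $C$ such that $\kappa(T_z)\le C$ for each $z\in\omega$.
   Context: All quasi-norms are assumed continuous. Fix a Hausdorff, locally compact, locally connected topological space $U$ (the space of parameters) and a continuous function $\delta:U\times U\to\mathbb{C}$ such that $\delta(z,w)=0$ if and only if $z=w$. Let $Z$ be a Hausdorff complex topological vector space (the ambient space). A family $\mathcal{F}$ of functions $U\to Z$ is called admissible (relative to $U,\delta,Z$) if: (1) $\mathcal{F}$ is a complex vector space with a quasi-norm $\|\cdot\|_{\mathcal{F}}$ for which it is complete; (2) for each $w\in U$ the evaluation map $\mathcal{F}\to Z$, $f\mapsto f(w)$, is continuous; (3) for each compact $K\subseteq U$ there is a positive constant $D_K(\mathcal{F})$ such that for any $w\in K$ and any $f\in\mathcal{F}$ with $f(w)=0$, the map $U\setminus\{w\}\ni z\mapsto f(z)/\delta(z,w)\in Z$ extends to an element of $\mathcal{F}$ with $\left\|f(\cdot)/\delta(\cdot,w)\right\|_{\mathcal{F}}\le D_K(\mathcal{F})\|f\|_{\mathcal{F}}$. The intermediate spaces are $X_w:=\{f(w): f\in\mathcal{F}\}\subseteq Z$, $w\in U$, with quasi-norm $\|x\|_w:=\inf\{\|f\|_{\mathcal{F}}: f\in\mathcal{F},\ f(w)=x\}$; they are quasi-Banach spaces. The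 collection $\{X_w\}_{w\in U}$ is called an interpolation scale. Let $\{X_w\}_{w\in U}$ be an interpolation scale with ambient space $Z$ and admissible family $\mathcal{F}$, and $\{Y_w\}_{w\in U}$ an interpolation scale with ambient space $W$ and admissible family $\mathcal{G}$ (same $U$ and $\delta$). A family of operators $T_w:X_w\to W$, $w\in U$, is called an interpolating family of operators if the assignment $\mathcal{F}\ni f\mapsto[U\ni w\mapsto T_w(f(w))]\in\mathcal{G}$ is well defined, linear, and satisfies $\|T_{\cdot}(f(\cdot))\|_{\mathcal{G}}\le M\|f\|_{\mathcal{F}}$ for all $f\in\mathcal{F}$, for some finite $M>0$. Then each $T_w$ maps $X_w$ linearly and boundedly into $Y_w$. For quasi-Banach spaces $X,Y$ and a bounded linear $T:X\to Y$, $\kappa(T;X,Y)$ is the smallest constant such that for every $y\in Y$ there is $x\in X$ with $Tx=y$ and $\|x\|_X\le\kappa(T;X,Y)\|y\|_Y$ (it is $+\infty$ if no such finite constant exists; it is finite iff $T$ is onto). Write $\kappa(T_w):=\kappa(T_w;X_w,Y_w)$. *)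

(* Defs.v *)
From HB Require Import structures.
From mathcomp Require Import all_boot all_order all_algebra.
From mathcomp Require Import all_classical all_reals all_analysis.
From mathcomp Require Export complex.

Set Implicit Arguments.
Unset Strict Implicit.
Unset Printing Implicit Defensive.

Import Order.TTheory GRing.Theory Num.Theory.
Import numFieldNormedType.Exports.

Local Open Scope classical_set_scope.
Local Open Scope ring_scope.
Local Open Scope complex_scope.

Definition locally_connected (U : topologicalType) : Prop :=
  forall (x : U) (A : set U), nbhs x A ->
  exists B : set U, [/\ open B, connected B, B x & B `<=` A].

Section QuasiNorm.
Context {R : realType} {V : lmodType R[i]}.
Implicit Types (X : set V) (n : V -> R).

(* Neighbourhoods of x in the vector topology that the quasi-norm n induces
   on X; n is only meaningful on X. *)
Definition quasi_nbhs X n (x : V) : set_system V :=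
  [set A | exists2 e : R, 0 < e &
    forall y, X y -> n (y - x) < e -> A y].

Definition is_subspace X : Prop :=
  X 0 /\ (forall (a : R[i]) x y, X x -> X y -> X (a *: x + y)).

(* Quasi-norms are required to be continuous for the topology they induce;
   this is not automatic. *)
Record is_quasi_norm X n : Prop := IsQuasiNorm {
  quasi_norm_ge0 : forall x, X x -> 0 <= n x ;
  quasi_norm_eq0 : forall x, X x -> n x = 0 -> x = 0 ;
  quasi_normZ : forall (a : R[i]) x, X x -> (n (a *: x))%:C = `|a| * (n x)%:C ;
  quasi_normD : exists2 k : R, 1 <= k &
    forall x y, X x -> X y -> n (x + y) <= k * (n x + n y) ;
  quasi_norm_continuous : forall x, X x -> n @ quasi_nbhs X n x --> n x }.

Definition quasi_complete X n : Prop :=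
  forall u : nat -> V, (forall i, X (u i)) ->
  (forall e : R, 0 < e -> \forall i & j \near \oo, n (u i - u j) < e) ->
  exists2 x, X x & n (u i - x) @[i --> \oo] --> (0 : R).

End QuasiNorm.

Section Kappa.
Context {R : realType} {V W : Type}.

(* Only the values of T and nX on X, and of nY on Y, matter.  The infimum of
   the admissible constants is taken in the extended reals, so that it is +oo
   when there is none. *)
Definition kappa (T : V -> W) (X : set V) (nX : V -> R) (Y : set W)
    (nY : W -> R) : \bar R :=
  ereal_inf [set C%:E | C in [set C : R | 0 <= C /\
    forall y, Y y -> exists x, [/\ X x, T x = y & nX x <= C * nY y]]].

End Kappa.

Section InterpolationScale.
Context {R : realType} {U : topologicalType} (delta : U -> U -> R[i]).

Section AdmissibleFamily.
Context {Z : topologicalLmodType R[i]} (F : set (U -> Z)) (nF : (U -> Z) -> R).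

(* Vector operations on F are pointwise.  The topology on Z is not assumed
   locally convex. *)
Record admissible : Prop := Admissible {
  admissible_subspace : is_subspace F ;
  admissible_quasi_norm : is_quasi_norm F nF ;
  admissible_complete : quasi_complete F nF ;
  admissible_eval : forall (w : U) f, F f ->
    (fun g : U -> Z => g w) @ quasi_nbhs F nF f --> f w ;
  admissible_div : forall K : set U, compact K ->
    exists2 D : R, 0 < D & forall (w : U) f, K w -> F f -> f w = 0 ->
      exists g, [/\ F g, forall z, z <> w -> g z = (delta z w)^-1 *: f z
                  & nF g <= D * nF f] }.

Definition inter_space (w : U) : set Z := [set f w | f in F].

Definition inter_norm (w : U) (x : Z) : R :=
  inf [set nF f | f in [set f | F f /\ f w = x]].

End AdmissibleFamily.

Section InterpolatingOperators.
Context {Z W : topologicalLmodType R[i]}.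

(* T w stands for an operator X_w -> W: its values off X_w are irrelevant. *)
Definition lift_op (T : U -> Z -> W) (f : U -> Z) : U -> W :=
  fun w => T w (f w).

Record interpolating_family (F : set (U -> Z)) (nF : (U -> Z) -> R)
    (G : set (U -> W)) (nG : (U -> W) -> R) (T : U -> Z -> W) : Prop :=
  InterpolatingFamily {
  interpolating_maps : forall f, F f -> G (lift_op T f) ;
  interpolating_linear : forall (a : R[i]) f g, F f -> F g ->
    lift_op T (a *: f + g) = a *: lift_op T f + lift_op T g ;
  interpolating_bounded : exists2 M : R, 0 < M &
    forall f, F f -> nG (lift_op T f) <= M * nF f }.

Definition kappa_at (F : set (U -> Z)) (nF : (U -> Z) -> R)
    (G : set (U -> W)) (nG : (U -> W) -> R) (T : U -> Z -> W) (w : U) :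
    \bar R :=
  kappa (T w) (inter_space F w) (inter_norm F nF w)
    (inter_space G w) (inter_norm G nG w).

End InterpolatingOperators.
End InterpolationScale.

(* Main.v *)
(* Given g in G, surjectivity of T_w0 yields f_0 in F with
   T_w0 (f_0 w0) = g w0, so g - T f_0 vanishes at w0 and equals
   delta(., w0) g_1 with g_1 in G and ||g_1|| <= A ||g||.  Iterating,
     g = T (sum_(j < n) delta(., w0)^j f_j) + delta(., w0)^n g_n.
   For a fixed z with d = delta(z, w0) small, the series f = sum_j d^j f_j, now
   with constant coefficients, converges in F.  The remainder d^n g_n tends to 0
   in G, so evaluating at z gives g z = T_z (f z), with ||f|| <= C ||g||. *)
Require Import Defs.
From HB Require Import structures.
From mathcomp Require Import all_boot all_order all_algebra.
From mathcomp Require Import all_classical all_reals all_analysis.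
From mathcomp Require Import complex.
From mathcomp Require Import ring lra.

Set Implicit Arguments.
Unset Strict Implicit.
Unset Printing Implicit Defensive.

Import Order.TTheory GRing.Theory Num.Theory.
Import numFieldNormedType.Exports.

Local Open Scope classical_set_scope.
Local Open Scope ring_scope.

Section Subspace.
Context {R : realType} {V : lmodType R[i]} (X : set V) (subX : is_subspace X).

Lemma subspaceZ (a : R[i]) x : X x -> X (a *: x).
Proof. by case: subX => X0 XZD Xx; rewrite -[_ *: _]addr0; apply: XZD. Qed.

Lemma subspaceD x y : X x -> X y -> X (x + y).
Proof. by case: subX => _ XZD Xx Xy; rewrite -[x]scale1r; apply: XZD. Qed.

Lemma subspaceB x y : X x -> X y -> X (x - y).
Proof.
by move=> Xx Xy; rewrite -scaleN1r; apply: subspaceD => //; apply: subspaceZ.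
Qed.

Lemma subspace_sum (a : nat -> V) m p :
  (forall j, X (a j)) -> X (\sum_(m <= j < p) a j).
Proof. by move=> Xa; apply: big_ind => //; [case: subX | exact: subspaceD]. Qed.

End Subspace.

(** * Quasi-norms and geometrically dominated series *)

Section QuasiNormTheory.
Context {R : realType} {V : lmodType R[i]} (X : set V) (n : V -> R).
Hypotheses (subX : is_subspace X) (qnX : is_quasi_norm X n).

Lemma quasi_normZE (a : R[i]) x :
  X x -> n (a *: x) = ComplexField.Normc.normc a * n x.
Proof.
move=> Xx; apply: complexI; rewrite (quasi_normZ qnX)// rmorphM/=.
by rewrite normc_def; case: a.
Qed.

Lemma quasi_norm0 : n 0 = 0.
Proof.
have X0 : X 0 by case: subX.
by have := quasi_normZE 0 X0; rewrite scale0r ComplexField.Normc.normc0 mul0r.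
Qed.

Lemma quasi_norm_subC x y : X x -> X y -> n (x - y) = n (y - x).
Proof.
move=> Xx Xy; rewrite -[x - y]opprB -[- (y - x)]scaleN1r quasi_normZE; last exact: subspaceB.
by rewrite normcN ComplexField.Normc.normc1 mul1r.
Qed.

Section Series.
Variables (k B t : R) (a : nat -> V).
Hypotheses (k1 : 1 <= k) (B0 : 0 <= B) (t0 : 0 <= t) (kt : k * t <= 2^-1).
Hypothesis nD : forall x y, X x -> X y -> n (x + y) <= k * (n x + n y).
Hypothesis Xa : forall j, X (a j).
Hypothesis na : forall j, n (a j) <= B * t ^+ j.

(* As k t <= 1/2, peeling off the first term of the sum reproduces the bound:
   k (B t^m + 2 k B t^(m+1)) <= 2 k B t^m. *)
Lemma quasi_norm_sum_le m p :
  n (\sum_(m <= j < m + p) a j) <= 2 * k * B * t ^+ m.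
Proof.
have k0 : 0 <= k := le_trans ler01 k1.
elim: p m => [|p IHp] m.
  by rewrite addn0 big_geq// quasi_norm0 !mulr_ge0// exprn_ge0.
rewrite big_ltn ?addnS ?ltnS ?leq_addr// -addSn.
apply: le_trans (nD _ _) _ => //; first exact: subspace_sum.
have {IHp} := IHp m.+1; have := na m; rewrite exprS.
have Bt : 0 <= B * t ^+ m by rewrite mulr_ge0// exprn_ge0.
move=> le1 le2; have le3 : k * t * (B * t ^+ m) <= 2^-1 * (B * t ^+ m) by rewrite ler_wpM2r.
rewrite -!mulrA (mulrCA 2) ler_wpM2l//. lra.
Qed.

(** A quasi-norm has no countable triangle inequality, so absolute summability would not suffice.
    Geometric decay with [k * t <= 2^-1] does, since it bounds all blocks of the series uniformly.
    Passing to the limit costs one more factor [k]. *)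
Lemma quasi_norm_series : quasi_complete X n ->
  exists x, [/\ X x, n x <= 2 * k ^+ 2 * B
    & n (\sum_(0 <= j < i) a j - x) @[i --> \oo] --> (0 : R)].
Proof.
move: (k1) (t0) (kt) (B0) => k_ge1 t_ge0 kt_le B_ge0.
move=> complX; pose S i := \sum_(0 <= j < i) a j.
have XS i : X (S i) by exact: subspace_sum.
have t1 : `|t| < 1 by rewrite ger0_norm//; nra.
have SB i j : (j <= i)%N -> n (S i - S j) <= 2 * k * B * t ^+ j.
  move=> ji; rewrite /S (big_cat_nat (leq0n j) ji)//= addrAC subrr add0r -{1}(subnKC ji).
  exact: quasi_norm_sum_le.
have [|x Xx Sx] := complX S XS.
  move=> e e0.
  have := cvgr0_norm_lt _ (cvg_geometric (2 * k * B) t1) _ e0.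
  case=> N _ HN; exists ([set i | (N <= i)%N], [set i | (N <= i)%N]).
    by split; exists N.
  have close i j : (j <= i)%N -> (N <= j)%N -> n (S i - S j) < e.
    move=> ji /HN/=; apply: le_lt_trans; apply: le_trans (ler_norm _).
    exact: SB.
  move=> [i j] /= [Ni Nj]; case/orP: (leq_total j i) => [ji|ij]; first exact: close.
  by rewrite quasi_norm_subC//; exact: close.
exists x; split=> //.
(* Split [x] as [(x - S N) + S N]. The tolerance [e / k] absorbs the factor [k] of the
   quasi-triangle inequality, leaving exactly [2 * k ^+ 2 * B + e]. *)
apply/ler_addgt0Pr => e e0.
have /(cvgr0_norm_lt _ Sx)[N _ /(_ N)/= SNx] : 0 < e / k by rewrite divr_gt0//; lra.
have {}SNx := le_lt_trans (ler_norm _) (SNx (leqnn N)).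
rewrite -(subrK (S N) x).
apply: le_trans (nD _ _) _ => //; first exact: subspaceB.
rewrite quasi_norm_subC//.
have := quasi_norm_sum_le 0 N; rewrite add0n expr0 mulr1 -/(S N) => SN.
apply: (@le_trans _ _ (k * (e / k + 2 * k * B))).
  by apply: ler_wpM2l; lra.
rewrite le_eqVlt; apply/orP; left; apply/eqP; field; lra.
Qed.

End Series.
End QuasiNormTheory.

(** * Evaluation and lifting in an admissible family *)

Section AdmissibleTheory.
Context {R : realType} {U : topologicalType} (delta : U -> U -> R[i]).
Context {Z : topologicalLmodType R[i]} (F : set (U -> Z)) (nF : (U -> Z) -> R).
Hypotheses (hausZ : hausdorff_space Z) (admF : admissible delta F nF).

Let subF := admissible_subspace admF.
Let qnF := admissible_quasi_norm admF.

(** Continuity of evaluation at the zero function puts [c] in every neighborhood of 0, and [Z] is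
    Hausdorff. *)
Lemma admissible_eval_eq0 w (c : Z) :
  (forall e : R, 0 < e -> exists f, [/\ F f, f w = c & nF f < e]) -> c = 0.
Proof.
move=> small; apply: hausZ => A B cA B0; have F0 : F 0 by case: subF.
have /(_ B B0)[e e0 He] := admissible_eval admF (w := w) F0.
have [f [Ff fc fe]] := small e e0.
exists c; split; first exact: nbhs_singleton.
by rewrite -fc; apply: He => //; rewrite subr0.
Qed.

Lemma inter_norm_le w f : F f -> inter_norm F nF w (f w) <= nF f.
Proof.
move=> Ff; apply: ge_inf; last by exists f.
by exists 0 => _ [g [Fg _] <-]; exact: (quasi_norm_ge0 qnF).
Qed.

(** The infimum need not be attained, hence the factor 2. *)
Lemma inter_norm_lift w x : inter_space F w x ->
  exists f, [/\ F f, f w = x & nF f <= 2 * inter_norm F nF w x].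
Proof.
move=> [f Ff fx].
have infx : has_inf [set nF g | g in [set g | F g /\ g w = x]].
  split; first by exists (nF f), f.
  by exists 0 => _ [g [Fg _] <-]; exact: (quasi_norm_ge0 qnF).
have x0 : 0 <= inter_norm F nF w x.
  apply: lb_le_inf; first by case: infx.
  by move=> _ [g [Fg _] <-]; exact: (quasi_norm_ge0 qnF).
(* The factor 2 gives no slack when the infimum is 0. In that case [x] has lifts of arbitrarily
   small quasi-norm, so [x = 0] and the zero function lifts it. *)
have [xE|x_neq0] := eqVneq (inter_norm F nF w x) 0.
  exists 0; split; first by case: subF.
    apply/esym/(@admissible_eval_eq0 w) => e e0.
    have [_ [g [Fg gx] <-]] := inf_adherent e0 infx.
    by rewrite -/(inter_norm F nF w x) xE add0r; exists g.
  by rewrite xE mulr0 (quasi_norm0 subF qnF).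
have xgt0 : 0 < inter_norm F nF w x by rewrite lt_neqAle eq_sym x_neq0.
have [_ [g [Fg gx] <-] /ltW gle] := inf_adherent xgt0 infx.
by exists g; split=> //; rewrite mulr2n mulrDl mul1r.
Qed.

End AdmissibleTheory.

(** * Lifting through an interpolating family near [w0] *)

Section InterpolatingTheory.
Context {R : realType} {U : topologicalType} (delta : U -> U -> R[i]).
Hypothesis delta_eq0 : forall z w, delta z w = 0 <-> z = w.
Context {Z W : topologicalLmodType R[i]}.
Hypotheses (hausZ : hausdorff_space Z) (hausW : hausdorff_space W).
Context (F : set (U -> Z)) (nF : (U -> Z) -> R) (G : set (U -> W))
  (nG : (U -> W) -> R) (T : U -> Z -> W).
Hypotheses (admF : admissible delta F nF) (admG : admissible delta G nG).
Hypothesis interpT : interpolating_family F nF G nG T.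

Let subF := admissible_subspace admF.
Let qnF := admissible_quasi_norm admF.
Let subG := admissible_subspace admG.
Let qnG := admissible_quasi_norm admG.

Lemma lift_opB f g :
  F f -> F g -> lift_op T (f - g) = lift_op T f - lift_op T g.
Proof.
move=> Ff Fg; rewrite -[- g]scaleN1r addrC (interpolating_linear interpT)//.
by rewrite scaleN1r addrC.
Qed.

Lemma lift_opD f g :
  F f -> F g -> lift_op T (f + g) = lift_op T f + lift_op T g.
Proof.
by move=> Ff Fg; rewrite -{1}[f]scale1r (interpolating_linear interpT)// scale1r.
Qed.

Lemma lift_op0 : lift_op T 0 = 0.
Proof.
have F0 : F 0 by case: subF.
by rewrite -[X in lift_op T X](subrr 0) lift_opB// subrr.
Qed.

Lemma lift_opZ a f : F f -> lift_op T (a *: f) = a *: lift_op T f.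
Proof.
have F0 : F 0 by case: subF.
move=> Ff; rewrite -[a *: f]addr0 (interpolating_linear interpT)//.
by rewrite lift_op0 addr0.
Qed.

(* Correct g at w0 by the image of some f, and divide the error by delta. *)
Lemma interpolating_step w0 : (kappa_at F nF G nG T w0 < +oo)%E ->
  exists A B : R, [/\ 0 < A, 0 <= B & forall g, G g -> exists f g1,
    [/\ F f, G g1, nF f <= B * nG g, nG g1 <= A * nG g
      & forall z, g z = T z (f z) + delta z w0 *: g1 z]].
Proof.
move=> /ereal_inf_lt[_ [C [C0 CP] <-] _].
have [M M0 TM] := interpolating_bounded interpT.
have [k k1 nGD] := quasi_normD qnG.
have [D D0 divG] := admissible_div admG (@compact_set1 _ w0).
have MC : 0 <= M * (2 * C) by rewrite !mulr_ge0// ltW.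
(* Here [2 * C] comes from the near-optimal lift of a preimage of [g w0], [k * (1 + M * (2 * C))]
   bounds [g - lift_op T f], and [D] is the cost of dividing by [delta] at [w0]. *)
exists (D * (k * (1 + M * (2 * C)))), (2 * C); split.
- by rewrite !mulr_gt0//; lra.
- by rewrite mulr_ge0.
move=> g Gg.
have [|x [Xx Tx nx]] := CP (g w0); first by exists g.
have [f [Ff fx nf]] := inter_norm_lift hausZ admF Xx.
have {nx}nf : nF f <= 2 * C * nG g.
  have := ler_wpM2l C0 (inter_norm_le admG w0 Gg); lra.
have GTf := interpolating_maps interpT Ff.
have Gh : G (g - lift_op T f) by exact: subspaceB.
have nh : nG (g - lift_op T f) <= k * (1 + M * (2 * C)) * nG g.
  rewrite -[- _]scaleN1r; apply: le_trans (nGD _ _ _ _) _ => //.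
    exact: subspaceZ.
  rewrite (quasi_normZE qnG)// normcN ComplexField.Normc.normc1 mul1r.
  rewrite -mulrA ler_wpM2l//; first lra.
  have := ler_wpM2l (ltW M0) nf; have := TM f Ff; lra.
have [|g1 [Gg1 g1E ng1]] := divG w0 (g - lift_op T f) erefl Gh.
  by rewrite !fctE /lift_op fx Tx subrr.
exists f, g1; split=> //.
  by apply: le_trans ng1 _; rewrite -[leRHS]mulrA ler_wpM2l// ltW.
(* The quotient is prescribed only off [w0]; at [w0] the factor [delta w0 w0 = 0] makes its value
   irrelevant. *)
move=> z; have [->|zw0] := pselect (z = w0).
  by rewrite fx Tx (delta_eq0 _ _).2// scale0r addr0.
rewrite g1E// scalerA divff ?scale1r; last by apply/eqP => /delta_eq0.
by rewrite !fctE /lift_op addrCA subrr addr0.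
Qed.

(** The constants [A] and [B] of the iterated step depend only on [w0], so [r] and [C] serve all [z]
    and [g] at once; [f] itself depends on [z]. *)
Lemma interpolating_lift w0 : (kappa_at F nF G nG T w0 < +oo)%E ->
  exists r C : R, [/\ 0 < r, 0 < C & forall z g,
    ComplexField.Normc.normc (delta z w0) < r -> G g ->
    exists f, [/\ F f, T z (f z) = g z & nF f <= C * nG g]].
Proof.
move=> /interpolating_step[A [B [A0 B0 step]]].
have [M M0 TM] := interpolating_bounded interpT.
have [k k1 nFD] := quasi_normD qnF.
have [l l1 nGD] := quasi_normD qnG.
have kA0 : 0 < k * A by rewrite mulr_gt0//; lra.
(* This radius gives [k * t <= 2^-1] for [t = |d| * A], as the series lemma requires. The [+ 1]
   keeps the constant positive when [B = 0]. *)
exists (2^-1 / (k * A)), (2 * k ^+ 2 * B + 1); split.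
- by rewrite divr_gt0.
- by rewrite ltr_wpDl// !mulr_ge0//; lra.
move=> z g dz Gg; set d := delta z w0 in dz *.
have [s sP] : {s & forall h, G h -> [/\ F (s h).1, G (s h).2,
    nF (s h).1 <= B * nG h, nG (s h).2 <= A * nG h
    & forall z, h z = T z ((s h).1 z) + delta z w0 *: (s h).2 z]}.
  apply: (@choice _ _ (fun h s => G h -> [/\ F s.1, G s.2,
    nF s.1 <= B * nG h, nG s.2 <= A * nG h
    & forall z, h z = T z (s.1 z) + delta z w0 *: s.2 z])) => h.
  have [/step[f [g1 h1]]|nGh] := pselect (G h); first by exists (f, g1).
  by exists (0, 0).
pose gs j := iter j (fun h => (s h).2) g.
pose fs j := (s (gs j)).1.
pose a j := d ^+ j *: fs j.
have Ggs j : G (gs j) by elim: j => //= j /sP[].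
have Ffs j : F (fs j) by case: (sP _ (Ggs j)).
have Fa j : F (a j) by exact: subspaceZ.
have ngs j : nG (gs j) <= A ^+ j * nG g.
  elim: j => [|j IHj]; first by rewrite expr0 mul1r.
  case: (sP _ (Ggs j)) => _ _ _ /le_trans -> //.
  by rewrite exprS -mulrA ler_wpM2l// ltW.
pose t := ComplexField.Normc.normc d * A.
have d_ge0 : 0 <= ComplexField.Normc.normc d.
  by rewrite /ComplexField.Normc.normc; case: (d) => ? ?; exact: sqrtr_ge0.
have t0 : 0 <= t by rewrite mulr_ge0// ltW.
have kt : k * t <= 2^-1.
  rewrite mulrCA -ler_pdivlMr//; exact: ltW.
have normX j : ComplexField.Normc.normc (d ^+ j) =
    ComplexField.Normc.normc d ^+ j.
  elim: j => [|j IHj]; first by rewrite !expr0 ComplexField.Normc.normc1.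
  by rewrite !exprS ComplexField.Normc.normcM IHj.
have g0 : 0 <= nG g := quasi_norm_ge0 qnG Gg.
have na j : nF (a j) <= B * nG g * t ^+ j.
  rewrite (quasi_normZE qnF)// normX exprMn mulrCA ler_wpM2l ?exprn_ge0//.
  case: (sP _ (Ggs j)) => _ _ /le_trans -> //.
  by rewrite -mulrA (mulrC (nG g)) ler_wpM2l.
have [f [Ff nf Sf]] := quasi_norm_series subF qnF k1 (mulr_ge0 B0 g0) t0 kt
  nFD Fa na (admissible_complete admF).
exists f; split=> //; last first.
  by apply: le_trans nf _; lra.
pose S i := \sum_(0 <= j < i) a j.
have FS i : F (S i) by exact: subspace_sum.
(* The identity is claimed at the fixed point [z] only, where [delta z w0] is the constant [d]. *)
have gE i : g z = lift_op T (S i) z + d ^+ i *: gs i z.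
  elim: i => [|i IHi].
    by rewrite /S big_geq// lift_op0 expr0 scale1r add0r.
  rewrite /S big_nat_recr//= -/(S i) lift_opD// lift_opZ// IHi.
  rewrite !fctE -addrA; congr (_ + _).
  case: (sP _ (Ggs i)) => _ _ _ _ /(_ z) {1}->.
  by rewrite scalerDr scalerA -exprSr.
have t1 : `|t| < 1 by rewrite ger0_norm//; nra.
apply/esym/eqP; rewrite -subr_eq0; apply/eqP.
apply: (admissible_eval_eq0 hausW admG (w := z)) => e e0.
(* All [h i] take the same value [g z - T z (f z)] at [z], while [nG (h i)] tends to 0; that value
   is therefore 0. *)
pose h i := d ^+ i *: gs i + lift_op T (S i - f).
have Gh i : G (h i).
  apply: subspaceD => //; first exact: subspaceZ.
  by apply: (interpolating_maps interpT); exact: subspaceB.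
have hE i : h i z = g z - T z (f z).
  by rewrite /h lift_opB// (gE i) !fctE /lift_op addrCA addrA.
have nh i : nG (h i) <= l * (t ^+ i * nG g + M * nF (S i - f)).
  apply: le_trans (nGD _ _ _ _) _; first exact: subspaceZ.
    by apply: (interpolating_maps interpT); exact: subspaceB.
  rewrite ler_wpM2l//; first lra.
  apply: lerD; last by apply: TM; exact: subspaceB.
  rewrite (quasi_normZE qnG)// normX exprMn -mulrA ler_wpM2l//.
  exact: exprn_ge0.
have lim0 : l * (t ^+ i * nG g + M * nF (S i - f)) @[i --> \oo] --> (0 : R).
  rewrite -[X in _ --> X](mulr0 l); apply: cvgMr.
  rewrite -[X in _ --> X]addr0; apply: cvgD.
    by rewrite -[X in _ --> X](mul0r (nG g)); apply: cvgMl; exact: cvg_expr.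
  by rewrite -[X in _ --> X](mulr0 M); apply: cvgMr.
have [N _ /(_ N (leqnn N))/= small] := cvgr0_norm_lt _ lim0 _ e0.
exists (h N); split=> //.
exact: le_lt_trans (le_trans (nh N) (ler_norm _)) small.
Qed.

End InterpolatingTheory.

Theorem theorem2p3 (R : realType) (U : topologicalType)
    (hausU : hausdorff_space U)
    (lcptU : locally_compact [set: U])
    (lconnU : locally_connected U)
    (delta : U -> U -> R[i])
    (delta_cont : continuous (fun p : U * U => delta p.1 p.2 : R[i]^o))
    (delta_eq0 : forall z w, delta z w = 0 <-> z = w)
    (Z W : topologicalLmodType R[i])
    (hausZ : hausdorff_space Z) (hausW : hausdorff_space W)
    (F : set (U -> Z)) (nF : (U -> Z) -> R) (admF : admissible delta F nF)
    (G : set (U -> W)) (nG : (U -> W) -> R) (admG : admissible delta G nG)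
    (T : U -> Z -> W) (interpT : interpolating_family F nF G nG T)
    (w0 : U) (kappa_fin : (kappa_at F nF G nG T w0 < +oo)%E) :
  exists omega : set U, nbhs w0 omega /\
    exists C : R, 0 < C /\
      forall z, omega z -> (kappa_at F nF G nG T z <= C%:E)%E.
Proof.
have [r [C [r0 C0 lift]]] := interpolating_lift delta_eq0 hausZ hausW admF admG
  interpT kappa_fin.
(* This set is a neighborhood of [w0] because [delta] is continuous and vanishes at [(w0, w0)]. *)
exists [set z | ComplexField.Normc.normc (delta z w0) < r]; split.
  have cont : {for w0, continuous (fun z => delta z w0 : R[i]^o)}.
    apply: (@continuous_comp _ _ _ (fun z => (z, w0))
      (fun p : U * U => delta p.1 p.2 : R[i]^o)); last exact: delta_cont.
    by apply: cvg_pair; [exact: cvg_id | exact: cvg_cst].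
  have delta0 : delta z w0 @[z --> w0] --> (0 : R[i]^o).
    by rewrite -[X in _ --> X]((delta_eq0 w0 w0).2 erefl); exact: cont.
  have rC : (0 : R[i]) < r%:C%C by rewrite ltcR.
  have := @cvgr0_norm_lt _ (R[i]^o : normedModType R[i]) _ _ (nbhs_filter w0) _ delta0 _ rC.
  apply: filterS => z /=.
  by rewrite normc_def ltcR; case: (delta z w0).
(* The factor 2 pays for lifting [y] to some [g] in [G] before [lift] applies. *)
exists (2 * C); split; first by rewrite mulr_gt0.
move=> z /= dz; apply: ereal_inf_lbound; exists (2 * C) => //.
split; first by rewrite mulr_ge0// ltW.
move=> y Yy; have [g [Gg gy ng]] := inter_norm_lift hausW admG Yy.
have [f [Ff Tf nf]] := lift z g dz Gg.
exists (f z); split; first by exists f.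
  by rewrite Tf.
apply: le_trans (inter_norm_le admF z Ff) _; apply: le_trans nf _.
by rewrite (mulrC 2) -mulrA ler_wpM2l// ltW.
Qed.
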